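(* The group cohomology of the binary octahedral group $\mathcal{O}$ with (trivial) integer coefficients is, for $q\ge0$, $$H^q(\mathcal{O},\mathbb{Z})\cong\begin{cases}\mathbb{Z}&\text{if }q=0,\\ \mathbb{Z}/48\mathbb{Z}&\text{if }q>0\text{ and }q\equiv0\pmod4,\\ \mathbb{Z}/2\mathbb{Z}&\text{if }q\equiv2\pmod4,\\ 0&\text{otherwise.}\end{cases}$$
   Context: $\mathcal{O}$ is the subgroup of order 48 of the group of unit quaternions generated by $\frac12(-1+i+j+k)$ and $\frac{1}{\sqrt2}(1+i)$. *)

(* Defs.v *)
From HB Require Import structures.
From mathcomp Require Import all_boot all_order all_algebra.
From mathcomp Require Import ring.
From mathcomp Require Import boolp classical_sets functions reals.

Set Implicit Arguments.
Unset Strict Implicit.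
Unset Printing Implicit Defensive.

Import Order.TTheory GRing.Theory Num.Theory.

Local Open Scope ring_scope.

(* [Quaternion a b c d] is a + b i + c j + d k. *)
Record quaternion (R : Type) := Quaternion { qre : R; qi : R; qj : R; qk : R }.

Definition quaternion_tuple (R : Type) (x : quaternion R) : R * R * R * R :=
  let: Quaternion a b c d := x in (a, b, c, d).
Definition tuple_quaternion (R : Type) (x : R * R * R * R) : quaternion R :=
  let: (a, b, c, d) := x in Quaternion a b c d.
Lemma quaternion_tupleK (R : Type) :
  cancel (@quaternion_tuple R) (@tuple_quaternion R).
Proof. by case. Qed.

HB.instance Definition _ (R : choiceType) :=
  Choice.copy (quaternion R) (can_type (@quaternion_tupleK R)).

Section Quaternions.
Variable R : comNzRingType.
Implicit Types x y z : quaternion R.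

Definition qone : quaternion R := Quaternion 1 0 0 0.

Definition qmul x y : quaternion R :=
  let: Quaternion a b c d := x in
  let: Quaternion a' b' c' d' := y in
  Quaternion (a * a' - b * b' - c * c' - d * d')
             (a * b' + b * a' + c * d' - d * c')
             (a * c' - b * d' + c * a' + d * b')
             (a * d' + b * c' - c * b' + d * a').

Definition qconj x : quaternion R :=
  let: Quaternion a b c d := x in Quaternion a (- b) (- c) (- d).

Definition qnormsq x : R :=
  let: Quaternion a b c d := x in a ^+ 2 + b ^+ 2 + c ^+ 2 + d ^+ 2.

Lemma qmulA : associative qmul.
Proof. by move=> [? ? ? ?] [? ? ? ?] [? ? ? ?] /=; congr Quaternion; ring. Qed.

Lemma qmul1x : left_id qone qmul.
Proof. by move=> [? ? ? ?] /=; congr Quaternion; ring. Qed.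

Lemma qmulx1 : right_id qone qmul.
Proof. by move=> [? ? ? ?] /=; congr Quaternion; ring. Qed.

Lemma qmul_conjl x : qmul (qconj x) x = Quaternion (qnormsq x) 0 0 0.
Proof. by case: x => [? ? ? ?] /=; congr Quaternion; ring. Qed.

Lemma qmul_conjr x : qmul x (qconj x) = Quaternion (qnormsq x) 0 0 0.
Proof. by case: x => [? ? ? ?] /=; congr Quaternion; ring. Qed.

Lemma qnormsqM x y : qnormsq (qmul x y) = qnormsq x * qnormsq y.
Proof. by case: x y => [? ? ? ?] [? ? ? ?] /=; ring. Qed.

Lemma qnormsq_conj x : qnormsq (qconj x) = qnormsq x.
Proof. by case: x => [? ? ? ?] /=; ring. Qed.

Lemma qnormsq1 : qnormsq qone = 1.
Proof. by rewrite /=; ring. Qed.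

Record unit_quaternion :=
  UnitQuaternion { uqval :> quaternion R; _ : qnormsq uqval == 1 }.

HB.instance Definition _ := [isSub for uqval].
HB.instance Definition _ := [Choice of unit_quaternion by <:].

Implicit Types u v w : unit_quaternion.

Lemma uqvalP u : qnormsq u == 1. Proof. by case: u. Qed.

Lemma uqmul_subproof u v : qnormsq (qmul u v) == 1.
Proof. by rewrite qnormsqM (eqP (uqvalP u)) (eqP (uqvalP v)) mulr1. Qed.

Lemma uqconj_subproof u : qnormsq (qconj u) == 1.
Proof. by rewrite qnormsq_conj uqvalP. Qed.

Definition uqone := UnitQuaternion (introT eqP qnormsq1).
Definition uqmul u v := UnitQuaternion (uqmul_subproof u v).
Definition uqconj u := UnitQuaternion (uqconj_subproof u).

Lemma uqmulA : associative uqmul.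
Proof. by move=> u v w; apply: val_inj; apply: qmulA. Qed.

Lemma uqmul1x : left_id uqone uqmul.
Proof. by move=> u; apply: val_inj; apply: qmul1x. Qed.

Lemma uqmulx1 : right_id uqone uqmul.
Proof. by move=> u; apply: val_inj; apply: qmulx1. Qed.

Lemma uqmulVx : left_inverse uqone uqconj uqmul.
Proof.
by move=> u; apply: val_inj; rewrite /= qmul_conjl (eqP (uqvalP u)).
Qed.

Lemma uqmulxV : right_inverse uqone uqconj uqmul.
Proof.
by move=> u; apply: val_inj; rewrite /= qmul_conjr (eqP (uqvalP u)).
Qed.

HB.instance Definition _ := isGroup.Build unit_quaternion
  uqmulA uqmul1x uqmulx1 uqmulVx uqmulxV.

End Quaternions.

Section GeneratedSubgroup.
Variables (G : groupType) (S : {pred G}).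

Definition subgroup_gen : {pred G} :=
  fun x => `[< forall H : {pred G},
                 group_closed H -> {subset S <= H} -> x \in H >].

Lemma subgroup_gen_closed : group_closed subgroup_gen.
Proof.
split; first by apply/asboolP => H [].
move=> x y /asboolP Sx /asboolP Sy; apply/asboolP => H clH SH.
by apply: clH.2; [apply: Sx | apply: Sy].
Qed.

(* The subgroup generated by S, as a group in its own right. *)
Record gen_subgroup := GenSubgroup
  { gen_subgroup_val :> G; _ : subgroup_gen gen_subgroup_val }.

HB.instance Definition _ := [isSub for gen_subgroup_val].
HB.instance Definition _ := [Choice of gen_subgroup by <:].
HB.instance Definition _ := SubChoice_isSubGroup.Build G subgroup_gen
  gen_subgroup subgroup_gen_closed.

End GeneratedSubgroup.

Section BinaryOctahedral.
Variable R : realType.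

(* (- 1 + i + j + k) / 2 *)
Lemma omega_subproof :
  qnormsq (Quaternion (- 2^-1) 2^-1 2^-1 2^-1 : quaternion R) == 1.
Proof. by apply/eqP => /=; field. Qed.

Definition omegaO : unit_quaternion R := UnitQuaternion omega_subproof.

(* (1 + i) / sqrt 2 *)
Lemma tau_subproof :
  qnormsq (Quaternion (Num.sqrt 2)^-1 (Num.sqrt 2)^-1 0 0 : quaternion R) == 1.
Proof.
by apply/eqP; rewrite /= exprVn sqr_sqrtr ?ler0n//; field.
Qed.

Definition tauO : unit_quaternion R := UnitQuaternion tau_subproof.

Definition binary_octahedral : groupType :=
  gen_subgroup (pred2 omegaO tauO).

End BinaryOctahedral.

Record gmodule (G : groupType) := GModule {
  gmod_sort :> zmodType;
  gact : G -> {additive gmod_sort -> gmod_sort};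
  gact1 : forall m, gact 1%g m = m;
  gactM : forall g h m, gact (g * h)%g m = gact g (gact h m)
}.

Definition trivial_gmodule (G : groupType) (A : zmodType) : gmodule G :=
  @GModule G A (fun=> idfun) (fun=> erefl) (fun _ _ _ => erefl).

Section GroupCohomology.
Variables (G : groupType) (M : gmodule G).

(* The cochains of the inhomogeneous (bar) complex, with no normalization. *)
Definition cochain (q : nat) : Type := ('I_q -> G) -> M.

HB.instance Definition _ q := GRing.Zmodule.on (cochain q).

(* (g_0, ..., g_q) |-> (g_0, ..., g_i g_(i+1), ..., g_q) if i < q,
   (g_0, ..., g_q) |-> (g_0, ..., g_(q-1))               if i = q. *)
Definition bar_merge (q : nat) (i : 'I_q.+1) (g : 'I_q.+1 -> G) : 'I_q -> G :=
  fun j => if (j < i)%N then g (widen_ord (leqnSn q) j)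
           else if (j == i :> nat)
           then (g (widen_ord (leqnSn q) j) * g (lift ord0 j))%g
           else g (lift ord0 j).

(* (d f)(g_0, ..., g_q) = g_0 . f(g_1, ..., g_q)
     + \sum_(i < q) (-1)^(i+1) f(g_0, ..., g_i g_(i+1), ..., g_q)
     + (-1)^(q+1) f(g_0, ..., g_(q-1)) *)
Definition coboundary (q : nat) (f : cochain q) : cochain q.+1 :=
  fun g => gact M (g ord0) (f (fun j => g (lift ord0 j)))
           + \sum_(i < q.+1) f (bar_merge i g) *~ (-1) ^+ i.+1.

Lemma coboundaryB q : zmod_morphism (@coboundary q).
Proof.
move=> f h; apply/funext => g; rewrite /coboundary !fctE raddfB /=.
rewrite opprD addrACA -sumrB; congr (_ + _); apply: eq_bigr => i _.
by rewrite mulrzBl.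
Qed.

HB.instance Definition _ q := GRing.isZmodMorphism.Build
  (cochain q) (cochain q.+1) (@coboundary q) (@coboundaryB q).

Definition is_cocycle q : {pred cochain q} := fun f => coboundary f == 0.

Lemma is_cocycle_zmod_closed q : zmod_closed (@is_cocycle q).
Proof.
split=> [|f h]; rewrite !unfold_in ?raddf0// => /eqP f0 /eqP h0.
by rewrite /is_cocycle coboundaryB f0 h0 subr0.
Qed.

Record cocycle q := Cocycle { cocycle_val :> cochain q;
                              _ : is_cocycle cocycle_val }.

HB.instance Definition _ q := [isSub for @cocycle_val q].
HB.instance Definition _ q := [Choice of cocycle q by <:].
HB.instance Definition _ q := GRing.SubChoice_isSubZmodule.Build
  (cochain q) (@is_cocycle q) (cocycle q) (@is_cocycle_zmod_closed q).

Definition is_coboundary q : {pred cocycle q} :=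
  match q with
  | 0 => fun f => f == 0
  | p.+1 => fun f => `[< exists h : cochain p, cocycle_val f = coboundary h >]
  end.

Lemma is_coboundary_zmod_closed q : zmod_closed (@is_coboundary q).
Proof.
case: q => [|q]; split.
- by rewrite unfold_in.
- by move=> f h; rewrite !unfold_in => /eqP -> /eqP ->; rewrite subr0.
- by apply/asboolP; exists 0; rewrite raddf0.
- move=> f h /asboolP[f' ff'] /asboolP[h' hh']; apply/asboolP.
  by exists (f' - h'); rewrite coboundaryB -ff' -hh'.
Qed.

HB.instance Definition _ q := GRing.isZmodClosed.Build (cocycle q)
  (@is_coboundary q) (@is_coboundary_zmod_closed q).

(* H^q is Z^q / B^q; the boolean predicate B^q is decided classically. *)
Definition group_cohomology (q : nat) : zmodType :=
  Quotient.quot (@is_coboundary q).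

End GroupCohomology.

Definition zmod_isomorphic (A B : zmodType) : Prop :=
  exists f : {additive A -> B}, bijective f.

(* Main.v *)
From HB Require Import structures.
Require Import Defs.
From mathcomp Require Import all_boot all_order all_algebra reals.
From mathcomp Require Import ring zify.
From mathcomp Require Import boolp classical_sets functions.

(** The binary octahedral group O is generated by s = (1 + i + j + k) / 2 and
    t = (1 + i) / sqrt 2, which satisfy tst = s^2 and sts = t^3.  Let B_n be
    the coinduced module of all functions from O to Z^n.  The proof rests on an
    exact sequence of O-modules

      0 -> Z -> B_1 -d0-> B_2 -d1-> B_2 -d2-> B_1 -aug-> Z -> 0

    in which d0 takes the differences of a function along s and t, d1 sums
    such pairs along the two relators (it is their Fox Jacobian), d2
    expresses the identity (1 - s) tst/s^2 + (1 - t) sts/t^3 = 0 between the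
    relators, and aug sums over the group.  It is the cochain complex that an
    equivariant cell structure on the 3-sphere with 1, 2, 2 and 1 free orbits of
    cells gives.

    Coinduced modules are acyclic: the bar complex has an explicit contraction
    on them ([coboundary_contract]).  Cutting the sequence into short exact
    sequences and shifting dimension four times ([shift], [relative_isS]) gives
    H^(q+4)(O, Z) = H^q(O, Z) for q > 0 ([periodicity]), and reduces H^1, ...,
    H^4 to the sequence of invariants

      Z -0-> Z^2 -d1-> Z^2 -0-> Z -48-> Z,   d1 (a, b) = (2b - a, 2a - 2b).

    Here d1 is injective with cokernel Z/2, so the groups in degrees 1 to 4 are
    0, Z/2, 0 and Z/48.  Finally, H^0 consists of the invariants of Z.

    Exactness is a statement about integer functions on 48, 96, 96 and 48
    cells.  It is proved by an acyclic matching in the sense of discrete Morse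
    theory: cells of consecutive dimensions are paired off so that each pair has
    incidence number 1 or -1 and the pairs form triangular systems.  If w is a
    cocycle, the pairs joining its cells to lower ones give u with d u = w on
    the cells that they contain, and the pairs joining the other cells to higher
    ones force d u = w there too ([matching_exact]).  The matching is found and
    verified by computation in a model of O by integer quaternions
    ([octahedral_model]). *)

Set Implicit Arguments.
Unset Strict Implicit.
Unset Printing Implicit Defensive.

Import Order.TTheory GRing.Theory Num.Theory.
Local Open Scope ring_scope.

(** * Cochains and change of coefficients *)

Definition equivariant (G : groupType) (M N : gmodule G)
  (f : {additive M -> N}) := forall g m, f (gact M g m) = gact N g (f m).

Definition push (G : groupType) (M N : gmodule G) (f : {additive M -> N}) q
  (c : cochain M q) : cochain N q := fun g => f (c g).

Section Push.
Variables (G : groupType) (M N : gmodule G) (f : {additive M -> N}).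

Lemma push_is_zmod_morphism q : zmod_morphism (@push G M N f q).
Proof. by move=> c d; apply/funext => g; rewrite /push !fctE raddfB. Qed.

HB.instance Definition _ q := GRing.isZmodMorphism.Build
  (cochain M q) (cochain N q) (@push G M N f q) (@push_is_zmod_morphism q).

Hypothesis fG : equivariant f.

Lemma coboundary_push q (c : cochain M q) :
  coboundary (push f c) = push f (coboundary c).
Proof.
apply/funext => g; rewrite /coboundary /push raddfD raddf_sum fG; congr (_ + _).
by apply: eq_bigr => i _; rewrite raddfMz.
Qed.

End Push.

(** * Coinduced modules are acyclic *)

Section Coinduced.
Variables (G : groupType) (A : zmodType).

(** Left translations [ltrans] commute with this right-handed action, so every
    combination of left translations is a map of modules; this is how the
    differentials of the exact sequence arise. *)
Definition coind_act (g : G) (f : G -> A) : G -> A := fun x => f (x * g)%g.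

Lemma coind_act_is_zmod_morphism g : zmod_morphism (coind_act g).
Proof. by []. Qed.

HB.instance Definition _ g := GRing.isZmodMorphism.Build
  (G -> A) (G -> A) (coind_act g) (coind_act_is_zmod_morphism g).

Lemma coind_act1 f : coind_act 1 f = f.
Proof. by apply/funext => x; rewrite /coind_act mulg1. Qed.

Lemma coind_actM g h f : coind_act (g * h) f = coind_act g (coind_act h f).
Proof. by apply/funext => x; rewrite /coind_act mulgA. Qed.

Definition coind : gmodule G :=
  @GModule G (G -> A) (fun g => coind_act g) coind_act1 coind_actM.

Definition fcons q (x : G) (g : 'I_q -> G) : 'I_q.+1 -> G :=
  fun j => if unlift ord0 j is Some i then g i else x.

Lemma fcons0 q x (g : 'I_q -> G) : fcons x g ord0 = x.
Proof. by rewrite /fcons unlift_none. Qed.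

Lemma fcons_lift q x (g : 'I_q -> G) i : fcons x g (lift ord0 i) = g i.
Proof. by rewrite /fcons liftK. Qed.

Lemma bar_merge_fcons0 q x (g : 'I_q.+1 -> G) :
  bar_merge ord0 (fcons x g)
  = fcons (x * g ord0)%g (fun j => g (lift ord0 j)).
Proof.
apply/funext => j; rewrite /bar_merge /=; case: (unliftP ord0 j) => [i|] ->.
  by rewrite !fcons_lift.
rewrite fcons_lift /= !fcons0 (_ : widen_ord _ _ = ord0) ?fcons0//.
exact: val_inj.
Qed.

Lemma bar_merge_fcons_lift q x (g : 'I_q.+1 -> G) (i : 'I_q.+1) :
  bar_merge (lift ord0 i) (fcons x g) = fcons x (bar_merge i g).
Proof.
apply/funext => j; rewrite {1}/bar_merge !fcons_lift.
case: (unliftP ord0 j) => [k|] ->; last first.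
  rewrite /= fcons0 (_ : widen_ord _ _ = ord0) ?fcons0//; exact: val_inj.
rewrite fcons_lift /bar_merge /= /bump /= !add1n ltnS eqSS.
by rewrite (_ : widen_ord _ _ = lift ord0 (widen_ord (leqnSn q) k))
  ?fcons_lift//; apply: val_inj.
Qed.

(** The contraction of the bar complex: the variable of the values of a
    cochain becomes a new first argument. *)
Definition contract q (c : cochain coind q.+1) : cochain coind q :=
  fun g x => c (fcons x g) 1%g.

Lemma contract_is_zmod_morphism q : zmod_morphism (@contract q).
Proof. by []. Qed.

HB.instance Definition _ q := GRing.isZmodMorphism.Build
  (cochain coind q.+1) (cochain coind q) (@contract q)
  (@contract_is_zmod_morphism q).

Lemma coind_sumE (I : Type) (r : seq I) (F : I -> coind) (x : G) :
  (\sum_(i <- r) F i) x = \sum_(i <- r) F i x.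
Proof. by elim/big_rec2: _ => // i y1 y2 _ <-. Qed.

Lemma coind_mulzE (a : coind) (n : int) (x : G) : (a *~ n) x = a x *~ n.
Proof.
have natE k : (a *+ k) x = a x *+ k.
  by elim: k => [|k IH]; rewrite ?mulr0n// !mulrS -IH.
by case: n => k /=; rewrite ?NegzE ?mulrNz -?pmulrn -natE.
Qed.

(** In [contract (coboundary c)] the leading term of the coboundary gives [c]
    back, its first merged face becomes the leading term of the coboundary of
    [contract c], and the other faces shift their index, hence their sign, by
    one. *)
Lemma coboundary_contract q (c : cochain coind q.+1) :
  coboundary (contract c) = c - contract (coboundary c).
Proof.
apply/funext => g; apply/funext => x.
apply: (canRL (addrK _)).
have pointE (f h : coind) y : (f + h) y = f y + h y by [].
rewrite /coboundary !pointE !coind_sumE.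
have -> : gact coind (g ord0) (contract c (fun j => g (lift ord0 j))) x
          = c (fcons (x * g ord0)%g (fun j => g (lift ord0 j))) 1%g by [].
have -> : contract (fun g0 : 'I_q.+2 -> G =>
    gact coind (g0 ord0) (c (fun j => g0 (lift ord0 j))) +
    \sum_(i < q.+2) c (bar_merge i g0) *~ (-1) ^+ i.+1) g x =
  c g x - c (fcons (x * g ord0)%g (fun j => g (lift ord0 j))) 1%g
    - \sum_(i < q.+1) (contract c (bar_merge i g) *~ (-1) ^+ i.+1) x.
  rewrite /contract pointE coind_sumE fcons0 /= /coind_act mul1g.
  rewrite (_ : (fun j => _) = g); last by apply/funext => j; rewrite fcons_lift.
  rewrite big_ord_recl bar_merge_fcons0 coind_mulzE expr1 mulrNz mulr1z addrA.
  congr (_ + _); rewrite -sumrN; apply: eq_bigr => i _.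
  by rewrite bar_merge_fcons_lift !coind_mulzE /= -mulrNz (exprS _ i.+1) mulN1r.
set u := c g x; set v := c _ _; set w := \sum_(i < _) _.
by rewrite -[u - v - w]addrA -opprD addrCA subrr addr0.
Qed.

Lemma contract_coboundary q (c : cochain coind q.+1) :
  contract (coboundary c) = c - coboundary (contract c).
Proof. by rewrite coboundary_contract opprB addrC subrK. Qed.

(** In degree 0 the contraction is only defined after one coboundary; there it
    changes the cochain by a constant function, which is invariant and so has
    coboundary 0. *)
Lemma contract_coboundary0 (c : cochain coind 0) :
  coboundary (contract (coboundary c)) = coboundary c.
Proof.
have -> : contract (coboundary c) = c - (fun g _ => c g 1%g).
  apply/funext => g; apply/funext => x.
  rewrite /contract /coboundary big_ord1 expr1 mulrNz mulr1z.
  rewrite [RHS](_ : _ = c g x - c g 1%g)//.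
  rewrite [LHS](_ : _ = gact coind (fcons x g ord0)
    (c (fun j => fcons x g (lift ord0 j))) 1%g - c (bar_merge ord0 (fcons x g)) 1%g)//.
  rewrite fcons0 /= /coind_act mul1g.
  rewrite (_ : (fun j => _) = g); last by apply/funext => -[].
  by rewrite (_ : bar_merge _ _ = g)//; apply/funext => -[].
rewrite raddfB /= [X in _ - X](_ : _ = 0) ?subr0//.
apply/funext => g; rewrite /coboundary big_ord1 expr1 mulrNz mulr1z.
apply/funext => x.
rewrite (_ : (_ - _) x = c (fun j => g (lift ord0 j)) 1%g -
  c (bar_merge ord0 g) 1%g)//.
rewrite (_ : bar_merge _ _ = (fun j => g (lift ord0 j))) ?subrr//.
by apply/funext => -[].
Qed.

Definition ltrans (w : G) (f : coind) : coind := fun x => f (w * x)%g.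

Lemma ltrans_is_zmod_morphism w : zmod_morphism (ltrans w).
Proof. by []. Qed.

HB.instance Definition _ w := GRing.isZmodMorphism.Build
  coind coind (ltrans w) (ltrans_is_zmod_morphism w).

Lemma ltrans_equivariant w : equivariant (ltrans w).
Proof.
by move=> g f; apply/funext => x; apply: (congr1 f); rewrite mulgA.
Qed.

(** The contraction formula carries the property from one degree to the next,
    which avoids the simplicial identities.  It gives the vanishing of the
    contracted double coboundary, that is of its values at 1; composing with
    left translations, which are maps of modules, reaches all other values. *)
Lemma coboundary_coboundary q (c : cochain coind q) :
  coboundary (coboundary c) = 0.
Proof.
have [n le_qn] := ubnP q; elim: n q le_qn c => // n IHn q le_qn c.
have IH p (b : cochain coind p) : (p < q)%N -> coboundary (coboundary b) = 0.
  by move=> lt_pq; apply: IHn; apply: leq_trans lt_pq _.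
suff H (b : cochain coind q) : contract (coboundary (coboundary b)) = 0.
  (* The value at w is the value at 1 of the translate by w. *)
  apply/funext => g; apply/funext => w.
  have : push (ltrans w) (coboundary (coboundary c)) g 1%g = 0.
    rewrite -!coboundary_push; try exact: ltrans_equivariant.
    set d := coboundary _.
    have -> : d g = d (fcons (g ord0) (fun j => g (lift ord0 j))).
      congr d; apply/funext => j.
      by case: (unliftP ord0 j) => [k|] ->; rewrite ?fcons_lift ?fcons0.
    by have /(congr1 (fun f => f (fun j => g (lift ord0 j)) (g ord0))) :=
      H (push (ltrans w) c).
  by rewrite -[X in _ -> _ X = _]mulg1.
rewrite contract_coboundary; case: q {c le_qn} b IH => [|q] b IH.
  by rewrite contract_coboundary0 subrr.
by rewrite contract_coboundary raddfB /= IH// subr0 subrr.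
Qed.

End Coinduced.

(** * Dimension shifting *)

(** A presentation of cohomology by a surjection from the cocycles with the
    coboundaries as kernel; unlike the quotient, it composes well with maps of
    cocycles. *)
Definition cohomology_is (G : groupType) (M : gmodule G) q (T : zmodType) :=
  exists phi : {additive cocycle M q -> T},
    (forall t, exists c, phi c = t) /\
    forall c, phi c = 0 <-> c \in @is_coboundary G M q.

Lemma quot_isomorphic (V T : zmodType) (I : zmodClosed V)
    (phi : {additive V -> T}) :
  (forall t, exists c, phi c = t) -> (forall c, phi c = 0 <-> c \in I) ->
  zmod_isomorphic (Quotient.quot I) T.
Proof.
move=> phi_surj phi_ker; pose Q : zmodType := Quotient.quot I.
pose f (x : Q) := phi (repr (x : Quotient.quot I)).
have fpi c : f (\pi_(Quotient.quot I) c)%qT = phi c.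
  apply/eqP; rewrite -subr_eq0 -raddfB; apply/eqP/phi_ker.
  by rewrite Quotient.idealrBE reprK.
have fB : zmod_morphism f.
  move=> x y; rewrite -[x](@reprK _ (Quotient.quot I)).
  rewrite -[y](@reprK _ (Quotient.quot I)).
  by rewrite -[X in f X]raddfB !fpi raddfB.
pose F := GRing.isZmodMorphism.Build Q T f fB.
pose F' : {additive Q -> T} := HB.pack f F.
exists F'; suff: bijective f by [].
have [g gK] := choice phi_surj.
exists (fun t => \pi_(Quotient.quot I) (g t))%qT => [x|t]; last by rewrite fpi.
rewrite -[RHS](@reprK _ (Quotient.quot I)).
by apply/eqP; rewrite -Quotient.idealrBE -phi_ker raddfB gK subrr.
Qed.

Lemma cohomology_is_isomorphic (G : groupType) (M : gmodule G) q (T : zmodType) :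
  cohomology_is M q T -> zmod_isomorphic (group_cohomology M q) T.
Proof.
move=> [phi [phi_surj phi_ker]].
exact: (@quot_isomorphic _ _ (@is_coboundary G M q) phi).
Qed.

(** The quotient of the cocycles of [C] by the images of the cocycles of [B].
    It is the cohomology of [C] in positive degree when [B] is coinduced, and
    the cokernel of the map between invariants in degree 0, so that a single
    dimension shift covers all degrees. *)
Definition relative_is (G : groupType) (B C : gmodule G)
    (p : {additive B -> C}) q (T : zmodType) :=
  exists phi : {additive cocycle C q -> T},
    (forall t, exists c, phi c = t) /\
    forall c, phi c = 0 <->
      exists b : cocycle B q, cocycle_val c = push p (cocycle_val b).

Lemma cocycleP (G : groupType) (M : gmodule G) q (c : cocycle M q) :
  coboundary (cocycle_val c) = 0.
Proof. by apply/eqP; apply: (valP c). Qed.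

Section DimensionShift.
Variables (G : groupType) (N : zmodType) (A C : gmodule G).
Notation B := (coind G N).
Variables (iota : {additive A -> B}) (p : {additive B -> C}).
Hypotheses (iotaG : equivariant iota) (pG : equivariant p).
Hypotheses (iota_inj : injective iota) (p_surj : forall c, exists b, p b = c).
Hypothesis p_iota : forall a, p (iota a) = 0.
Hypothesis p_ker : forall b, p b = 0 -> exists a, iota a = b.

Lemma push_surj q (c : cochain C q) : exists b, push p b = c.
Proof.
have [h hP] := choice (fun x => p_surj x).
by exists (fun g => h (c g)); apply/funext => g; apply: hP.
Qed.

Lemma push_ker q (b : cochain B q) :
  push p b = 0 -> exists a, push iota a = b.
Proof.
move=> pb0; have H g : exists a, iota a = b g.
  by apply: p_ker; apply: (congr1 (fun f => f g) pb0).
have [h hP] := choice H.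
by exists h; apply/funext.
Qed.

Lemma push_iota_inj q : injective (@push G A B iota q).
Proof.
move=> a b ab; apply/funext => g; apply: iota_inj.
exact: (congr1 (fun f => f g) ab).
Qed.

Lemma push_p_iota q (a : cochain A q) : push p (push iota a) = 0.
Proof. by apply/funext => g; apply: p_iota. Qed.

(** The inverse of the connecting homomorphism, made explicit by the
    contraction of [B]. *)
Definition shift_cochain q (a : cochain A q.+1) : cochain C q :=
  push p (contract (push iota a)).

Lemma shift_cocycle_subproof q (a : cocycle A q.+1) :
  is_cocycle (shift_cochain (cocycle_val a)).
Proof.
apply/eqP; rewrite coboundary_push// coboundary_contract coboundary_push//.
by rewrite cocycleP !raddf0 addr0 push_p_iota.
Qed.

Definition shift_cocycle q (a : cocycle A q.+1) : cocycle C q :=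
  Cocycle (shift_cocycle_subproof a).

Lemma shift_cocycle_is_zmod_morphism q : zmod_morphism (@shift_cocycle q).
Proof.
move=> a b; apply: val_inj; rewrite [LHS]/= [RHS]/=.
by rewrite /shift_cochain !raddfB.
Qed.

HB.instance Definition _ q := GRing.isZmodMorphism.Build
  (cocycle A q.+1) (cocycle C q) (@shift_cocycle q)
  (@shift_cocycle_is_zmod_morphism q).

(** In degree 0 this is the projection of a coinduced module to its constant
    functions, which are the invariants. *)
Lemma sub_contract_cocycle q (b : cochain B q) :
  is_cocycle (b - contract (coboundary b)).
Proof.
apply/eqP; rewrite raddfB /= coboundary_contract coboundary_coboundary.
by rewrite raddf0 addr0 subrr.
Qed.

(** The long exact sequence of a short exact sequence with coinduced middle
    term.  Surjectivity: the coboundary of a lift of [c] comes from [A], and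
    shifting it back recovers [c] up to a cocycle of [B]. *)
Lemma shift q (T : zmodType) : relative_is p q T -> cohomology_is A q.+1 T.
Proof.
move=> [phi [phi_surj phi_ker]].
exists (phi \o @shift_cocycle q); split=> [t|a] /=.
- have [c <-] := phi_surj t.
  have [b pb] := push_surj (cocycle_val c).
  have [a ab] : exists a, push iota a = coboundary b.
    by apply: push_ker; rewrite -coboundary_push// pb cocycleP.
  have a0 : is_cocycle a.
    apply/eqP; apply: push_iota_inj.
    by rewrite -coboundary_push// ab coboundary_coboundary raddf0.
  exists (Cocycle a0); apply/esym/eqP; rewrite -subr_eq0 -raddfB /=.
  apply/eqP/phi_ker; exists (Cocycle (sub_contract_cocycle b)).
  by rewrite /= /shift_cochain ab raddfB /= pb.
- rewrite phi_ker; split=> [[z az]|/asboolP[a' aa']].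
    have [a' a'E] : exists a', push iota a'
        = contract (push iota (cocycle_val a)) - cocycle_val z.
      by apply: push_ker; rewrite raddfB /= -az subrr.
    apply/asboolP; exists a'; apply: push_iota_inj.
    rewrite -coboundary_push// a'E raddfB /= cocycleP subr0.
    by rewrite coboundary_contract coboundary_push// cocycleP !raddf0 addr0.
  exists (- Cocycle (sub_contract_cocycle (push iota a'))).
  rewrite /= raddfN raddfB /= push_p_iota sub0r opprK.
  by rewrite /shift_cochain aa' coboundary_push.
Qed.

(** In positive degree every cocycle of a coinduced module is a coboundary,
    and every coboundary of [C] lifts to one of [B]. *)
Lemma relative_isS q (T : zmodType) :
  cohomology_is C q.+1 T -> relative_is p q.+1 T.
Proof.
move=> [phi [phi_surj phi_ker]]; exists phi; split=> // c.
rewrite phi_ker; split=> [/asboolP[c' cc']|[b cb]].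
  have [b pb] := push_surj c'.
  have b0 : is_cocycle (coboundary b).
    by apply/eqP; apply: coboundary_coboundary.
  by exists (Cocycle b0); rewrite cc' -pb coboundary_push.
apply/asboolP; exists (push p (contract (cocycle_val b))).
by rewrite coboundary_push// coboundary_contract cocycleP raddf0 addr0.
Qed.

End DimensionShift.

(** * Kernels and invariants *)

Section Kernel.
Variables (G : groupType) (M N : gmodule G) (f : {additive M -> N}).

Definition in_kernel : {pred M} := fun m => f m == 0.

Lemma in_kernel_zmod_closed : zmod_closed in_kernel.
Proof.
split=> [|x y]; rewrite !unfold_in ?raddf0// => /eqP x0 /eqP y0.
by rewrite /in_kernel raddfB x0 y0 subr0.
Qed.

Record kernel := Kernel { kernel_val : M; _ : in_kernel kernel_val }.

HB.instance Definition _ := [isSub for kernel_val].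
HB.instance Definition _ := [Choice of kernel by <:].
HB.instance Definition _ := GRing.SubChoice_isSubZmodule.Build
  M in_kernel kernel in_kernel_zmod_closed.

Lemma kernelP (x : kernel) : f (kernel_val x) = 0.
Proof. by apply/eqP; apply: (valP x). Qed.

Lemma kernel_val_is_zmod_morphism : zmod_morphism kernel_val.
Proof. by []. Qed.

HB.instance Definition _ := GRing.isZmodMorphism.Build kernel M kernel_val
  kernel_val_is_zmod_morphism.

Hypothesis fG : equivariant f.

Lemma kernel_act_subproof g (x : kernel) : in_kernel (gact M g (kernel_val x)).
Proof. by apply/eqP; rewrite fG kernelP raddf0. Qed.

Definition kernel_act g (x : kernel) : kernel := Kernel (kernel_act_subproof g x).

Lemma kernel_act_is_zmod_morphism g : zmod_morphism (kernel_act g).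
Proof. by move=> x y; apply: val_inj; apply: raddfB. Qed.

HB.instance Definition _ g := GRing.isZmodMorphism.Build kernel kernel
  (kernel_act g) (kernel_act_is_zmod_morphism g).

Lemma kernel_act1 x : kernel_act 1 x = x.
Proof. by apply: val_inj; apply: gact1. Qed.

Lemma kernel_actM g h x : kernel_act (g * h) x = kernel_act g (kernel_act h x).
Proof. by apply: val_inj; apply: gactM. Qed.

Definition kernel_gmodule : gmodule G :=
  @GModule G kernel (fun g => kernel_act g) kernel_act1 kernel_actM.

Definition kernel_incl : {additive kernel_gmodule -> M} := kernel_val.

Variables (B : gmodule G) (h : {additive B -> M}).
Hypotheses (hG : equivariant h) (fh0 : forall b, f (h b) = 0).

Lemma corestrict_subproof b : in_kernel (h b).
Proof. by apply/eqP. Qed.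

(** The next map of a complex lands in the kernel of the following one;
    exactness makes it the quotient map of a short exact sequence. *)
Definition corestrict_fun b : kernel_gmodule := Kernel (corestrict_subproof b).

Lemma corestrict_is_zmod_morphism : zmod_morphism corestrict_fun.
Proof. by move=> x y; apply: val_inj; apply: raddfB. Qed.

HB.instance Definition _ := GRing.isZmodMorphism.Build B kernel_gmodule
  corestrict_fun corestrict_is_zmod_morphism.

Definition corestrict : {additive B -> kernel_gmodule} := corestrict_fun.

Lemma corestrict_equivariant : equivariant corestrict.
Proof. by move=> g b; apply: val_inj; apply: hG. Qed.

End Kernel.

Section Invariants.
Variables (G : groupType).

Definition invariant_elt (M : gmodule G) (m : M) := forall g, gact M g m = m.

(** A cochain of degree 0 has the empty family as only argument, here written
    as a constant function. *)
Lemma is_cocycle0P (M : gmodule G) (c : cochain M 0) :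
  is_cocycle c <-> invariant_elt (c (fun=> 1%g)).
Proof.
have dE g : coboundary c g = gact M (g ord0) (c (fun=> 1%g)) - c (fun=> 1%g).
  rewrite /coboundary big_ord1 expr1 mulrNz mulr1z.
  by congr (gact M _ (c _) - c _); apply/funext => -[].
split=> [/eqP c0 g|inv]; last first.
  by apply/eqP/funext => g; rewrite dE inv subrr.
apply/eqP; rewrite -subr_eq0 -(dE (fun=> g)) c0; exact/eqP.
Qed.

Lemma relative_is0 (B C : gmodule G) (p : {additive B -> C}) (T : zmodType)
    (psi : {additive C -> T}) :
  (forall t, exists m, invariant_elt m /\ psi m = t) ->
  (forall m, invariant_elt m ->
     psi m = 0 <-> exists b, invariant_elt b /\ m = p b) ->
  relative_is p 0 T.
Proof.
move=> psi_surj psi_ker.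
pose phi (c : cocycle C 0) := psi (cocycle_val c (fun=> 1%g)).
have phiB : zmod_morphism phi by move=> c d; rewrite /phi -raddfB.
pose phiA := GRing.isZmodMorphism.Build _ _ phi phiB.
pose Phi : {additive cocycle C 0 -> T} := HB.pack phi phiA.
exists Phi; split=> [t|c].
  have [m [minv <-]] := psi_surj t.
  have m0 : is_cocycle ((fun=> m) : cochain C 0) by apply/is_cocycle0P.
  by exists (Cocycle m0).
have cinv : invariant_elt (cocycle_val c (fun=> 1%g)).
  by apply/is_cocycle0P; apply: (valP c).
rewrite [Phi c]/(phi c) /phi psi_ker//; split=> [[b [binv cb]]|[b cb]].
  have b0 : is_cocycle ((fun=> b) : cochain B 0) by apply/is_cocycle0P.
  exists (Cocycle b0); apply/funext => g; rewrite /push /= -cb.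
  by congr (cocycle_val c _); apply/funext => -[].
exists (cocycle_val b (fun=> 1%g)); split; last by rewrite cb.
by apply/is_cocycle0P; apply: (valP b).
Qed.

Lemma coind_invariant (N : zmodType) (f : coind G N) :
  invariant_elt f -> forall x, f x = f 1%g.
Proof. by move=> finv x; rewrite -{2}(finv x) /= /coind_act mul1g. Qed.

Definition cst (I : Type) (c : I -> int) : coind G (I -> int) := fun=> c.

Lemma cst_invariant I (c : I -> int) : invariant_elt (cst c).
Proof. by []. Qed.

Lemma invariant_cst I (f : coind G (I -> int)) : invariant_elt f -> f = cst (f 1%g).
Proof. by move=> finv; apply/funext => x; rewrite coind_invariant. Qed.

End Invariants.

Lemma kernel_invariant (G : groupType) (M M' : gmodule G) (f : {additive M -> M'})
  (fG : equivariant f) (m : kernel_gmodule fG) :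
  invariant_elt m <-> invariant_elt (kernel_val m).
Proof.
split=> minv g; first by rewrite -{2}(minv g).
by apply: val_inj; apply: minv.
Qed.

Lemma cohomology0 (G : groupType) :
  cohomology_is (trivial_gmodule G int) 0 int.
Proof.
pose phi (c : cocycle (trivial_gmodule G int) 0) : int :=
  cocycle_val c (fun=> 1%g).
have phiB : zmod_morphism phi by [].
pose phiA := GRing.isZmodMorphism.Build _ _ phi phiB.
pose Phi : {additive cocycle (trivial_gmodule G int) 0 -> int} := HB.pack phi phiA.
exists Phi; split=> [t|c].
  have t0 : is_cocycle ((fun=> t) : cochain (trivial_gmodule G int) 0).
    by apply/is_cocycle0P.
  by exists (Cocycle t0).
rewrite unfold_in /=; split=> [c0|/eqP-> //].
apply/eqP/val_inj/funext => g; rewrite /= -[RHS]c0.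
by congr (cocycle_val c _); apply/funext => -[].
Qed.

Section KernelShift.
Variables (G : groupType) (N : zmodType) (M M' : gmodule G).
Variables (f : {additive coind G N -> M}) (f' : {additive M -> M'}).
Hypotheses (fG : equivariant f) (f'G : equivariant f').
Hypothesis f'f : forall b, f' (f b) = 0.
Hypothesis ff'_exact : forall m, f' m = 0 -> exists b, f b = m.
Notation p := (corestrict f'G f'f).

Lemma corestrict_surj (c : kernel_gmodule f'G) : exists b, p b = c.
Proof.
have [b bc] := ff'_exact (kernelP c).
by exists b; apply: val_inj.
Qed.

Lemma kernel_incl_inj : injective (kernel_incl fG).
Proof. exact: val_inj. Qed.

Lemma corestrict_kernel (a : kernel_gmodule fG) : p (kernel_incl fG a) = 0.
Proof. by apply: val_inj; apply: kernelP. Qed.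

Lemma corestrict_eq0 b : p b = 0 -> exists a, kernel_incl fG a = b.
Proof.
move=> /(congr1 val) /= fb0.
have b0 : in_kernel f b by apply/eqP.
by exists (Kernel b0).
Qed.

(** The case of the short exact sequence between two consecutive kernels. *)
Lemma kernel_shift q (T : zmodType) :
  relative_is p q T -> cohomology_is (kernel_gmodule fG) q.+1 T.
Proof.
apply: (@shift _ _ _ _ (kernel_incl fG) p) => //.
- exact: corestrict_equivariant.
- exact: kernel_incl_inj.
- exact: corestrict_surj.
- exact: corestrict_kernel.
- exact: corestrict_eq0.
Qed.

Lemma kernel_shiftS q (T : zmodType) :
  cohomology_is (kernel_gmodule f'G) q.+1 T ->
  cohomology_is (kernel_gmodule fG) q.+2 T.
Proof.
move=> H; apply: kernel_shift; apply: relative_isS => //.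
- exact: corestrict_equivariant.
- exact: corestrict_surj.
Qed.

End KernelShift.

(** * Exactness from acyclic matchings *)

(** The pair (P, N) stands for the sum of P minus the sum of N, with
    multiplicities, so that a combination is seen to vanish by comparing two
    lists up to permutation. *)
Definition lincomb (C : Type) := (seq C * seq C)%type.

Definition lin (V : zmodType) (C : Type) (F : C -> V) (r : lincomb C) : V :=
  \sum_(c <- r.1) F c - \sum_(c <- r.2) F c.

Definition comp_lincomb (C C' : Type) (d : C' -> lincomb C) (r : lincomb C') : lincomb C :=
  (flatten [seq (d c).1 | c <- r.1] ++ flatten [seq (d c).2 | c <- r.2],
   flatten [seq (d c).2 | c <- r.1] ++ flatten [seq (d c).1 | c <- r.2]).

Lemma linB (V : zmodType) (C : Type) (F H : C -> V) r :
  lin (fun c => F c - H c) r = lin F r - lin H r.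
Proof. by rewrite /lin !sumrB !opprD !opprK addrACA. Qed.

Lemma lin_map (V : zmodType) (C C' : Type) (F : C -> V) (h : C' -> C) r :
  lin F (map h r.1, map h r.2) = lin (fun c => F (h c)) r.
Proof. by rewrite /lin !big_map. Qed.

Lemma lin_comp (V : zmodType) (C C' : Type) (F : C -> V) (d : C' -> lincomb C) r :
  lin (fun c => lin F (d c)) r = lin F (comp_lincomb d r).
Proof.
have flattenE (h : C' -> seq C) s : \sum_(c <- flatten (map h s)) F c =
    \sum_(c <- s) \sum_(c' <- h c) F c'.
  by rewrite big_flatten /= big_map.
rewrite /lin /comp_lincomb /= !big_cat /= !flattenE !sumrB.
by rewrite opprB !opprD addrACA [X in _ + X]addrC.
Qed.

Lemma eq_lin (V : zmodType) (C : eqType) (F F' : C -> V) (l : lincomb C) :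
  {in l.1 ++ l.2, F =1 F'} -> lin F l = lin F' l.
Proof.
move=> FF'; rewrite /lin; congr (_ - _); apply: eq_big_seq => c cin;
by apply: FF'; rewrite mem_cat cin ?orbT.
Qed.

Lemma lin_perm0 (V : zmodType) (C : eqType) (F : C -> V) (r : lincomb C) :
  perm_eq r.1 r.2 -> lin F r = 0.
Proof. by move=> r12; rewrite /lin (perm_big _ r12) subrr. Qed.

Section Matching.
Variables (C C' : eqType) (d : C' -> lincomb C).

(** Multiplicities are kept: a combination with a single unknown has it with
    coefficient 1 or -1. *)
Definition unknown (known : seq C) (r : lincomb C) :=
  [seq c <- r.1 ++ r.2 | c \notin known].

(** Each row [c'] determines the value at its partner [c] from values that are
    known before. *)
Fixpoint triangular (known : seq C) (ps : seq (C' * C)) : bool :=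
  if ps is (c', c) :: ps' then
    (unknown known (d c') == [:: c]) && triangular (c :: known) ps'
  else true.

(** The row of every cell that can be determined from the known cells alone,
    one row per cell.  Working by layers makes the first matching a
    breadth-first spanning tree of the Cayley graph; a spanning tree of
    another shape can be one that no matching of the relators extends. *)
Definition layer (rows : seq C') (known : seq C) : seq (C' * C) :=
  foldr (fun c' ps => if unknown known (d c') is [:: c] then
                        if c \in unzip2 ps then ps else (c', c) :: ps
                      else ps) [::] rows.

Fixpoint collapse (fuel : nat) (rows : seq C') (known : seq C) :=
  if fuel is n.+1 then
    let ps := layer rows known in
    ps ++ collapse n rows (unzip2 ps ++ known)
  else [::].

Variable V : zmodType.
Implicit Types (u : C -> V) (w : C' -> V).

Lemma lin_unknown known r c : unknown known r = [:: c] ->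
  exists b : bool, forall u, lin u r =
    lin u ([seq c <- r.1 | c \in known], [seq c <- r.2 | c \in known])
    + (if b then u c else - u c).
Proof.
have bigK u s : \sum_(c <- s) u c =
    \sum_(c <- [seq c <- s | c \in known]) u c +
    \sum_(c <- [seq c <- s | c \notin known]) u c.
  by rewrite (bigID (mem known)) /= !big_filter.
rewrite /unknown filter_cat.
case E1: [seq _ <- r.1 | _] => [|a s] /=.
  move=> E2; exists false => u.
  by rewrite /lin (bigK u r.1) (bigK u r.2) E1 E2 big_nil big_seq1 addr0 opprD addrA.
case: s E1 => [|? ?] E1; case E2: [seq _ <- r.2 | _] => //= -[<-].
exists true => u.
by rewrite /lin (bigK u r.1) (bigK u r.2) E1 E2 big_nil big_seq1 addr0 addrAC.
Qed.

Lemma eq_in_lin (known : seq C) u u' r : {in known, u' =1 u} ->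
  lin u' ([seq c <- r.1 | c \in known], [seq c <- r.2 | c \in known])
  = lin u ([seq c <- r.1 | c \in known], [seq c <- r.2 | c \in known]).
Proof.
move=> uu'; apply: eq_lin => c; rewrite -filter_cat mem_filter => /andP[ck _].
exact: uu'.
Qed.

Lemma unknown_notin known r c : unknown known r = [:: c] -> c \notin known.
Proof.
move=> E; have : c \in unknown known r by rewrite E mem_head.
by rewrite mem_filter => /andP[].
Qed.

(** The unknowns are determined one after the other, and rows already
    satisfied only involve values that do not change any more. *)
Lemma triangular_solve known ps w u : triangular known ps ->
  exists u', {in known, u' =1 u} /\
    forall c', c' \in unzip1 ps -> lin u' (d c') = w c'.
Proof.
elim: ps known u => [|[c' c] ps IH] known u /=; first by exists u.
case/andP=> /eqP E tri; have [b linE] := lin_unknown E.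
have cN := unknown_notin E.
pose v := w c' - lin u ([seq c <- (d c').1 | c \in known],
                        [seq c <- (d c').2 | c \in known]).
pose u1 x := if x == c then if b then v else - v else u x.
have u1u : {in known, u1 =1 u}.
  by move=> x xk; rewrite /u1; case: eqP => // xc; rewrite -xc xk in cN.
have [u' [u'u1 u'w]] := IH _ u1 tri.
have u'u : {in known, u' =1 u}.
  by move=> x xk; rewrite u'u1 ?u1u// inE xk orbT.
exists u'; split=> // x; rewrite inE => /orP[/eqP->|]; last exact: u'w.
rewrite linE (eq_in_lin _ u'u) u'u1 ?mem_head// /u1 eqxx.
by case: (b); rewrite ?opprK addrC subrK.
Qed.

(** The homogeneous counterpart: each row in turn says that one more value is
    zero. *)
Lemma triangular_force known ps u : triangular known ps ->
  {in known, forall c, u c = 0} ->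
  (forall c', c' \in unzip1 ps -> lin u (d c') = 0) ->
  {in known ++ unzip2 ps, forall c, u c = 0}.
Proof.
elim: ps known => [|[c' c] ps IH] known /=; first by rewrite cats0.
case/andP=> /eqP E tri u0 du0.
have [b linE] := lin_unknown E.
have uc0 : u c = 0.
  have := du0 c' (mem_head _ _); rewrite linE.
  rewrite (@eq_in_lin known (fun=> 0)) => [|x /u0//].
  rewrite /lin !big1_eq subrr add0r.
  by case: (b) => // /eqP; rewrite oppr_eq0 => /eqP.
move=> x; rewrite mem_cat inE orbCA => xin.
apply: (IH _ tri) => [y|y yin|].
- by rewrite inE => /orP[/eqP->|/u0].
- by apply: du0; rewrite inE yin orbT.
by rewrite mem_cat inE -orbA.
Qed.

End Matching.

Definition complex_ok (C0 C1 C2 : eqType) (d : C1 -> lincomb C0)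
    (D : C2 -> lincomb C1) (rows : seq C2) : bool :=
  all (fun c => perm_eq (comp_lincomb d (D c)).1 (comp_lincomb d (D c)).2) rows.

Definition matching_ok (C0 C1 C2 : eqType) (d : C1 -> lincomb C0)
    (D : C2 -> lincomb C1) (ps : seq (C1 * C0)) (qs : seq (C2 * C1))
    (cells : seq C1) (rows : seq C2) : bool :=
  [&& triangular D (unzip1 ps) qs,
      all (fun c => c \in unzip1 ps ++ unzip2 qs) cells &
      all (fun c => c \in rows) (unzip1 qs)].

(** The pairs [ps] give [u] with the required values on the matched cells; the
    difference of the two sides is then zero there and is annihilated by [D],
    so the pairs [qs] force it to vanish on the other cells. *)
Lemma matching_exact (V : zmodType) (C0 C1 C2 : eqType) (d : C1 -> lincomb C0)
    (D : C2 -> lincomb C1) k0 ps qs cells rows (w : C1 -> V) :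
  triangular d k0 ps -> complex_ok d D rows -> matching_ok d D ps qs cells rows ->
  {in rows, forall c2, lin w (D c2) = 0} ->
  exists u : C0 -> V, {in cells, forall c1, lin u (d c1) = w c1}.
Proof.
move=> tri_d dD0 /and3P[tri_D /allP cov /allP qs_rows] Dw0.
have [u [_ du]] := triangular_solve w (fun=> 0) tri_d.
exists u => c1 /cov c1in; apply/eqP; rewrite -subr_eq0; apply/eqP.
move: c1 c1in; apply: (triangular_force tri_D) => [c /du->|c2 /qs_rows c2in].
  by rewrite subrr.
by rewrite linB lin_comp Dw0// subr0 lin_perm0// (allP dD0).
Qed.

(** * The 48 quaternions *)

(** The pair (b, x) stands for the real quaternion x / 2 if b is false and x /
    sqrt 2 if b is true, which keeps the 48 elements of O integral. *)
Definition qcoord : Type := (bool * quaternion int)%type.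

Definition kone : qcoord := (false, Quaternion 2 0 0 0).

Definition khalf (x : int) : int := (x %/ 2)%Z.

(** The product of two numerators over sqrt 2 is already a numerator over 2;
    in the other cases the product of numerators has to be halved. *)
Definition kmul (x y : qcoord) : qcoord :=
  let z := qmul x.2 y.2 in
  (x.1 (+) y.1, if x.1 && y.1 then z else
     let: Quaternion a b c d := z in
     Quaternion (khalf a) (khalf b) (khalf c) (khalf d)).

Definition komega : qcoord := (false, Quaternion (-1) 1 1 1).
Definition ktau : qcoord := (true, Quaternion 1 1 0 0).
Definition ks : qcoord := (false, Quaternion 1 1 1 1).

(** The elements are products of the two generators; words of length 12 are
    enough to obtain all of them. *)
Definition elts : seq qcoord := Eval vm_compute in
  iter 12 (fun l => undup (l ++ map (kmul komega) l ++ map (kmul ktau) l))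
  [:: kone].

Definition kconj (x : qcoord) : qcoord := (x.1, qconj x.2).

Definition qmap (A B : Type) (f : A -> B) (x : quaternion A) : quaternion B :=
  let: Quaternion a b c d := x in Quaternion (f a) (f b) (f c) (f d).

(** The halving in [kmul] leaves no remainder. *)
Definition exact_mul (x y : qcoord) : bool :=
  (x.1 && y.1) || (qmap (fun a => 2 * a) (kmul x y).2 == qmul x.2 y.2).

(** Four times the squares of the real coordinates. *)
Definition sqnorms (x : qcoord) : quaternion int :=
  qmap (fun a => (if x.1 then 2 else 1) * a ^+ 2) x.2.

Lemma elts_generated : elts = iter 12
  (fun l => undup (l ++ map (kmul komega) l ++ map (kmul ktau) l)) [:: kone].
Proof. by vm_compute. Qed.

(** This table contains all that is needed to compare the 48 elements with the
    group: they are closed under division, and multiplication of coordinates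
    is multiplication of quaternions. *)
Lemma elts_mul : all (fun x => all (fun y =>
  [&& exact_mul x y, exact_mul x (kconj y), kmul x y \in elts
    & kmul x (kconj y) \in elts]) elts) elts.
Proof. by vm_compute. Qed.

Lemma kmul_elts : {in elts &, forall x y, kmul x y \in elts}.
Proof.
by move=> x y xin yin; have /and4P[] := allP (allP elts_mul x xin) y yin.
Qed.

Lemma elts_uniq : uniq elts. Proof. by vm_compute. Qed.

(** An element x / 2 differs from every element y / sqrt 2: the squares of
    their coordinates, which are rational, already tell them apart. *)
Lemma elts_parity : all (fun x => all (fun y =>
  (sqnorms x == sqnorms y) ==> (x.1 == y.1)) elts) elts.
Proof. by vm_compute. Qed.

Lemma kone_elts : kone \in elts. Proof. by []. Qed.
Lemma komega_elts : komega \in elts. Proof. by []. Qed.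
Lemma ktau_elts : ktau \in elts. Proof. by []. Qed.

Section Embedding.
Variable R : realType.

Definition scale (b : bool) : R := if b then (Num.sqrt 2)^-1 else 2^-1.

Definition emb (x : qcoord) : quaternion R :=
  qmap (fun a => scale x.1 * a%:~R) x.2.

Lemma scale_neq0 b : scale b != 0.
Proof.
by rewrite /scale; case: b; rewrite invr_eq0 ?sqrtr_eq0 ?pnatr_eq0// -ltNge.
Qed.

Lemma scale_sqr b : 4 * scale b * scale b = if b then 2 else 1.
Proof.
rewrite /scale; case: b; last by field.
by rewrite -mulrA -expr2 exprVn sqr_sqrtr ?ler0n//; field.
Qed.

Lemma scaleM b c : scale b * scale c = if b && c then 2^-1 else 2^-1 * scale (b (+) c).
Proof.
case: b; case: c; rewrite /= /scale.
- by rewrite -expr2 exprVn sqr_sqrtr ?ler0n.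
- by rewrite mulrC.
- by [].
- by [].
Qed.

Lemma embM x y : exact_mul x y -> emb (kmul x y) = qmul (emb x) (emb y).
Proof.
case: x y => [p x] [q y]; rewrite /exact_mul /emb.
have -> : qmul (qmap (fun a => scale p * a%:~R) x) (qmap (fun a => scale q * a%:~R) y)
   = qmap (fun a => scale p * scale q * a%:~R : R) (qmul x y).
  case: x y => [? ? ? ?] [? ? ? ?] /=.
  by rewrite !(rmorphD, rmorphB, rmorphN, rmorphM) /=; congr Quaternion; ring.
rewrite scaleM; have [/andP[-> ->] //|pq] := boolP (p && q).
rewrite /= (negbTE pq) /=.
case: (let: Quaternion _ _ _ _ := _ in _) => a b c d /eqP <- /=.
by rewrite !rmorphM /=; congr Quaternion; field.
Qed.

Lemma emb_conj x : emb (kconj x) = qconj (emb x).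
Proof.
by case: x => p [? ? ? ?]; rewrite /emb /=; congr Quaternion;
  rewrite rmorphN mulrN.
Qed.

Lemma emb_inj : {in elts &, injective emb}.
Proof.
move=> x y xin yin xy.
(* Equal elements have equal squares of coordinates, hence the same
   denominator; then the numerators agree. *)
have sqE z : qmap (fun a => a%:~R : R) (sqnorms z) = qmap (fun a => 4 * a ^+ 2) (emb z).
  case: z => p [a b c d] /=; rewrite /sqnorms /emb /= !exprMn !mulrA !scale_sqr.
  by rewrite !rmorphM /=; case: p.
have qmap_inj (f : int -> R) : injective f -> injective (qmap f).
  by move=> fI [? ? ? ?] [? ? ? ?] [] /fI -> /fI -> /fI -> /fI ->.
have /qmap_inj : injective (fun a : int => a%:~R : R) := @intr_inj R.
move=> /(_ (sqnorms x) (sqnorms y)); rewrite !sqE xy => /(_ erefl) /eqP sq.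
have /eqP par := implyP (allP (allP elts_parity x xin) y yin) sq.
case: x y par xy {xin yin sq} => [p x] [q y] /= <-.
rewrite /emb /= => xy; congr pair; apply: qmap_inj xy => a b.
by move/(mulfI (scale_neq0 p))/intr_inj.
Qed.

Lemma emb1 : emb kone = qone R.
Proof. by rewrite /emb /= !mulr0 mulVf ?pnatr_eq0. Qed.

Lemma emb_omega : emb komega = omegaO R.
Proof. by rewrite /emb /=; congr Quaternion; rewrite ?mulrN ?mulr1. Qed.

Lemma emb_tau : emb ktau = tauO R.
Proof. by rewrite /emb /= !mulr1 !mulr0. Qed.

Notation G := (binary_octahedral R).

Definition gval (g : G) : quaternion R := uqval (gen_subgroup_val g).

Lemma gvalM (g h : G) : gval (g * h)%g = qmul (gval g) (gval h).
Proof. by []. Qed.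

Lemma gval_inj : injective gval.
Proof. by move=> g h gh; do 2!apply: val_inj. Qed.

Lemma gval_elts (g : G) : exists2 k, k \in elts & gval g = emb k.
Proof.
rewrite /gval; have := valP g; rewrite [val g]/=.
move: (gen_subgroup_val g) => u /asboolP uin.
pose H : {pred unit_quaternion R} :=
  fun u => `[< exists2 k, k \in elts & uqval u = emb k >].
have HP v : reflect (exists2 k, k \in elts & uqval v = emb k) (v \in H).
  exact: asboolP.
suff uH : u \in H by apply/HP.
apply: uin => [|v].
  split; first by apply/HP; exists kone; rewrite ?kone_elts ?emb1.
  move=> x y /HP[k kin xk] /HP[l lin yl]; apply/HP.
  have /and4P[_ ex _ kl] := allP (allP elts_mul k kin) l lin.
  by exists (kmul k (kconj l)) => //; rewrite embM// emb_conj -xk -yl.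
rewrite inE => /orP[] /eqP ->; apply/HP.
  by exists komega; rewrite ?komega_elts ?emb_omega.
by exists ktau; rewrite ?ktau_elts ?emb_tau.
Qed.

Lemma elts_gval k : k \in elts -> exists g : G, gval g = emb k.
Proof.
have genS u : u \in [:: omegaO R; tauO R] -> subgroup_gen (pred2 (omegaO R) (tauO R)) u.
  by move=> uin; apply/asboolP => H _; apply; move: uin; rewrite !inE.
pose gom : G := GenSubgroup (genS _ (mem_head _ _)).
have tauin : tauO R \in [:: omegaO R; tauO R] by rewrite !inE eqxx orbT.
pose gtau : G := GenSubgroup (genS _ tauin).
have step l : (forall k, k \in l -> k \in elts /\ exists g : G, gval g = emb k) ->
   forall k, k \in undup (l ++ map (kmul komega) l ++ map (kmul ktau) l) ->
   k \in elts /\ exists g : G, gval g = emb k.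
  move=> IH {}k; rewrite mem_undup !mem_cat => /or3P[/IH//||] /mapP[x /IH[xin [g gx]] ->].
    have /and4P[ex _ kl _] := allP (allP elts_mul _ komega_elts) x xin.
    by split=> //; exists (gom * g)%g; rewrite gvalM embM// gx emb_omega.
  have /and4P[ex _ kl _] := allP (allP elts_mul _ ktau_elts) x xin.
  by split=> //; exists (gtau * g)%g; rewrite gvalM embM// gx emb_tau.
rewrite elts_generated; suff iterP n : forall k, k \in iter n
  (fun l => undup (l ++ map (kmul komega) l ++ map (kmul ktau) l)) [:: kone] ->
  k \in elts /\ exists g : G, gval g = emb k by case/iterP.
elim: n => [k0|n IH k0]; last by rewrite iterS => /(step _ IH).
by rewrite inE => /eqP ->; split; rewrite ?kone_elts//; exists 1%g; rewrite emb1.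
Qed.

(** The group and its 48 coordinate vectors are identified by mutually inverse
    maps; every later statement about the group uses only these four
    properties. *)
Lemma octahedral_model : exists (e : qcoord -> G) (r : G -> qcoord),
  [/\ forall g, r g \in elts, cancel r e, {in elts, cancel e r}
    & {in elts &, {morph e : x y / kmul x y >-> (x * y)%g}}].
Proof.
have [r rP] := choice (fun g => let: ex_intro2 k kin gk := gval_elts g in
  ex_intro (fun k => k \in elts /\ gval g = emb k) k (conj kin gk)).
have inv k : exists g : G, k \in elts -> gval g = emb k.
  have [/elts_gval[g gk]|kN] := boolP (k \in elts); first by exists g.
  by exists 1%g.
have [e eP] := choice inv.
exists e, r; split=> [g|g|k kin|k l kin lin].
- by have [] := rP g.
- by have [rin gE] := rP g; apply: gval_inj; rewrite eP.
- have [rin gE] := rP (e k); apply: emb_inj => //; by rewrite -gE eP.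
- have /and4P[ex _ kl _] := allP (allP elts_mul k kin) l lin.
  by apply: gval_inj; rewrite eP// gvalM !eP// embM.
Qed.

End Embedding.

(** * A complex of cells and its matching *)

(** A matrix over the group ring describes a map between free modules.  The
    row of the cell (j, k) is the row j of the matrix translated by k. *)
Definition cell_row (I J : Type) (D : J -> lincomb (I * qcoord)) (c : J * qcoord) :
    lincomb (I * qcoord) :=
  let act w := (w.1, kmul w.2 c.2) in (map act (D c.1).1, map act (D c.1).2).

Definition coaug_row (c : unit * qcoord) : lincomb unit := ([:: tt], [::]).

Definition D0 (j : bool) : lincomb (unit * qcoord) :=
  ([:: (tt, if j then ktau else ks)], [:: (tt, kone)]).

(** The index false is the relation tst = s^2 and true the relation sts = t^3,
    with edges false for s and true for t.  The edges of a word are met by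
    reading it from the right, since words act on the left: the word tst
    starting at 1 runs through the edge t at 1, the edge s at t and the edge t
    at st. *)
Definition D1 (j : bool) : lincomb (bool * qcoord) :=
  if j then
    ([:: (false, kone); (true, ks); (false, kmul ktau ks)],
     [:: (true, kone); (true, ktau); (true, kmul ktau ktau)])
  else
    ([:: (true, kone); (false, ktau); (true, kmul ks ktau)],
     [:: (false, kone); (false, ks)]).

(** The identity (1 - s) r1 + (1 - t) r2 = 0 between the relators, which makes
    d2 d1 vanish. *)
Definition D2 (j : unit) : lincomb (bool * qcoord) :=
  ([:: (false, kone); (true, kone)], [:: (false, ks); (true, ktau)]).

Definition aug_row (c : unit) : lincomb (unit * qcoord) :=
  ([seq (tt, k) | k <- elts], [::]).

Definition cells (I : Type) (s : seq I) : seq (I * qcoord) :=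
  [seq (i, k) | i <- s, k <- elts].
Notation cells1 := (cells [:: tt]).
Notation cells2 := (cells [:: false; true]).

(** The fuel bounds the number of layers.  Each matching starts from the cells
    that the previous one has used as rows, beginning with one vertex. *)
Definition pairs0 : seq ((unit * qcoord) * unit) := [:: ((tt, kone), tt)].
Definition pairs1 := Eval vm_compute in collapse (cell_row D0) 20 cells2 (unzip1 pairs0).
Definition pairs2 := Eval vm_compute in collapse (cell_row D1) 20 cells2 (unzip1 pairs1).
Definition pairs3 := Eval vm_compute in collapse (cell_row D2) 50 cells1 (unzip1 pairs2).
Definition pairs4 := Eval vm_compute in collapse aug_row 2 [:: tt] (unzip1 pairs3).

Lemma complex01 : complex_ok coaug_row (cell_row D0) cells2.
Proof. by vm_compute. Qed.
Lemma complex12 : complex_ok (cell_row D0) (cell_row D1) cells2.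
Proof. by vm_compute. Qed.
Lemma complex23 : complex_ok (cell_row D1) (cell_row D2) cells1.
Proof. by vm_compute. Qed.
Lemma complex34 : complex_ok (cell_row D2) aug_row [:: tt].
Proof. by vm_compute. Qed.

Lemma matching01 : matching_ok coaug_row (cell_row D0) pairs0 pairs1 cells1 cells2.
Proof. by vm_compute. Qed.
Lemma matching12 : matching_ok (cell_row D0) (cell_row D1) pairs1 pairs2 cells2 cells2.
Proof. by vm_compute. Qed.
Lemma matching23 : matching_ok (cell_row D1) (cell_row D2) pairs2 pairs3 cells2 cells1.
Proof. by vm_compute. Qed.
Lemma matching34 : matching_ok (cell_row D2) aug_row pairs3 pairs4 cells1 [:: tt].
Proof. by vm_compute. Qed.

(** * The exact sequence of coinduced modules *)

Section Operators.
Variables (G : groupType) (e : qcoord -> G) (r : G -> qcoord).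
Hypotheses (r_elts : forall g, r g \in elts) (rK : cancel r e).
Hypothesis eK : {in elts, cancel e r}.
Hypothesis eM : {in elts &, {morph e : x y / kmul x y >-> (x * y)%g}}.

(** The entries of the matrix lie among the 48 elements, where [kmul] is known
    to be the product of the group. *)
Definition words_ok (I J : Type) (D : J -> lincomb (I * qcoord)) :=
  forall j, all (fun c => c.2 \in elts) ((D j).1 ++ (D j).2).

Section Op.
Variables (I J : eqType) (D : J -> lincomb (I * qcoord)).

(** Left translations by the entries of a matrix over the group ring, combined
    along its rows. *)
Definition op_fun (f : coind G (I -> int)) : coind G (J -> int) :=
  fun x j => lin (fun c => f (e c.2 * x)%g c.1) (D j).

Lemma op_is_zmod_morphism : zmod_morphism op_fun.
Proof.
by move=> f h; apply/funext => x; apply/funext => j; apply: linB.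
Qed.

HB.instance Definition _ := GRing.isZmodMorphism.Build
  (coind G (I -> int)) (coind G (J -> int)) op_fun op_is_zmod_morphism.

Definition op : {additive coind G (I -> int) -> coind G (J -> int)} := op_fun.

Lemma op_equivariant : equivariant op.
Proof.
move=> g f; apply/funext => x; apply/funext => j.
by apply: eq_lin => c _; rewrite /= /coind_act mulgA.
Qed.

Definition cellfun (K : Type) (f : coind G (K -> int)) (c : K * qcoord) : int :=
  f (e c.2) c.1.

Definition uncellfun (K : Type) (F : K * qcoord -> int) : coind G (K -> int) :=
  fun x i => F (i, r x).

Hypothesis D_ok : words_ok D.

Lemma lin_cellfun f j k : k \in elts ->
  lin (cellfun f) (cell_row D (j, k)) = op f (e k) j.
Proof.
move=> kin; rewrite lin_map; apply: eq_lin => c cin.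
by rewrite /cellfun /= eM//; apply: (allP (D_ok j)).
Qed.

Lemma op_uncellfun F x j :
  op (uncellfun F) x j = lin F (cell_row D (j, r x)).
Proof.
rewrite lin_map; apply: eq_lin => c cin.
have win : c.2 \in elts by apply: (allP (D_ok j)).
by rewrite /uncellfun -{1}(rK x) -eM// eK// kmul_elts.
Qed.

End Op.

Lemma cells_elts (I J L : eqType) (D : J -> lincomb (I * qcoord)) j k :
  words_ok D -> k \in elts ->
  all (fun c => c.2 \in elts) ((cell_row D (j, k)).1 ++ (cell_row D (j, k)).2).
Proof.
move=> D_ok kin; rewrite /= -map_cat all_map; apply/allP => c cin /=.
by rewrite kmul_elts//; apply: (allP (D_ok j)).
Qed.

Lemma lin_cells_comp (I J : eqType) (D : J -> lincomb (I * qcoord)) f l :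
  words_ok D -> all (fun c => c.2 \in elts) (l.1 ++ l.2) ->
  lin (fun c => lin (cellfun f) (cell_row D c)) l = lin (cellfun (op D f)) l.
Proof.
move=> D_ok lin_elts; apply: eq_lin => -[j k] /(allP lin_elts) kin.
exact: lin_cellfun.
Qed.

Lemma mem_cells (I : eqType) (s : seq I) i k :
  ((i, k) \in cells s) = (i \in s) && (k \in elts).
Proof.
apply/allpairsP/andP => [[[i' k'] /= [? ? [-> ->]]]//|[iin kin]].
by exists (i, k).
Qed.

Lemma op_comp0 (I J L : eqType) (D : J -> lincomb (I * qcoord))
    (E : L -> lincomb (J * qcoord)) (s : seq L) f :
  words_ok D -> words_ok E -> s =i predT ->
  complex_ok (cell_row D) (cell_row E) (cells s) -> op E (op D f) = 0.
Proof.
move=> D_ok E_ok sT DE; apply/funext => g; apply/funext => l.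
rewrite -[g]rK -(lin_cellfun E_ok)// -(lin_cells_comp _ D_ok); last first.
  exact: cells_elts.
rewrite lin_comp lin_perm0//; apply: (allP DE).
by rewrite mem_cells sT r_elts.
Qed.

(** The exactness of the complex of cells, transported along the
    identification of the group with the 48 elements. *)
Lemma op_exact (I J L : eqType) (D : J -> lincomb (I * qcoord))
    (E : L -> lincomb (J * qcoord)) k0 ps qs (s : seq J) (s' : seq L) w :
  words_ok D -> words_ok E -> s =i predT ->
  triangular (cell_row D) k0 ps ->
  complex_ok (cell_row D) (cell_row E) (cells s') ->
  matching_ok (cell_row D) (cell_row E) ps qs (cells s) (cells s') ->
  op E w = 0 -> exists u, op D u = w.
Proof.
move=> D_ok E_ok sT tri DE mat Ew0.
have [|U DU] := matching_exact (w := cellfun w) tri DE mat.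
  move=> [l k]; rewrite mem_cells => /andP[_ kin].
  by rewrite lin_cellfun// Ew0.
exists (uncellfun U); apply/funext => g; apply/funext => j.
rewrite op_uncellfun// DU ?mem_cells ?sT ?r_elts//.
by rewrite /cellfun /= rK.
Qed.

Definition coaug_fun (n : trivial_gmodule G int) : coind G (unit -> int) :=
  fun _ _ => n.

Lemma coaug_is_zmod_morphism : zmod_morphism coaug_fun.
Proof. by []. Qed.

HB.instance Definition _ := GRing.isZmodMorphism.Build
  (trivial_gmodule G int) (coind G (unit -> int)) coaug_fun coaug_is_zmod_morphism.

Definition coaug : {additive trivial_gmodule G int -> coind G (unit -> int)} :=
  coaug_fun.

Definition aug_fun (f : coind G (unit -> int)) : trivial_gmodule G int :=
  lin (cellfun f) (aug_row tt).

Lemma aug_is_zmod_morphism : zmod_morphism aug_fun.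
Proof. by move=> f h; apply: linB. Qed.

HB.instance Definition _ := GRing.isZmodMorphism.Build
  (coind G (unit -> int)) (trivial_gmodule G int) aug_fun aug_is_zmod_morphism.

Definition aug : {additive coind G (unit -> int) -> trivial_gmodule G int} :=
  aug_fun.

Lemma augE f : aug f = \sum_(k <- elts) f (e k) tt.
Proof.
rewrite -[aug f]/(\sum_(c <- [seq (tt, k) | k <- elts]) cellfun f c
  - \sum_(c <- [::]) cellfun f c).
by rewrite big_map big_nil subr0.
Qed.

(** Right translation permutes the group. *)
Lemma aug_equivariant : equivariant aug.
Proof.
move=> g f; rewrite -[RHS]/(aug f) [LHS]augE.
have perm_e : perm_eq [seq (e k * g)%g | k <- elts] [seq e k | k <- elts].
  apply: uniq_perm.
  - rewrite map_inj_in_uniq; first exact: elts_uniq.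
    by move=> x y xin yin /mulIg exy; rewrite -[x]eK// exy eK.
  - rewrite map_inj_in_uniq; first exact: elts_uniq.
    by move=> x y xin yin exy; rewrite -[x]eK// exy eK.
  move=> x; apply/mapP/mapP => _; first by exists (r x).
  by exists (r (x * g^-1)%g) => //; rewrite rK -mulgA mulVg mulg1.
transitivity (\sum_(x <- [seq (e k * g)%g | k <- elts]) f x tt).
  by rewrite big_map.
by rewrite augE (perm_big _ perm_e) big_map.
Qed.

Lemma aug_const (f : coind G (unit -> int)) :
  invariant_elt f -> aug f = f 1%g tt *+ 48.
Proof.
move=> finv; rewrite augE (eq_bigr (fun=> f 1%g tt)) => [|k _].
  (* The list of elements has length 48, by computation. *)
  by rewrite big_const_seq iter_addr_0 count_predT.
by rewrite coind_invariant.
Qed.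

Lemma coaug_inj : injective coaug.
Proof. by move=> m n /(congr1 (fun f => f 1%g tt)). Qed.

Lemma D0_ok : words_ok D0. Proof. by case. Qed.
Lemma D1_ok : words_ok D1. Proof. by case. Qed.
Lemma D2_ok : words_ok D2. Proof. by case. Qed.

Lemma aug_row_ok : words_ok aug_row.
Proof. by case; vm_compute. Qed.

Lemma D0_coaug n : op D0 (coaug n) = 0.
Proof.
apply/funext => g; apply/funext => j.
by case: j; rewrite /= /op_fun /lin /= !big_seq1 /= subrr.
Qed.

Lemma D0_exact f : op D0 f = 0 -> exists n, coaug n = f.
Proof.
move=> Df0; have tri0 : triangular coaug_row [::] pairs0 by [].
have [|U EU] := matching_exact (w := cellfun f) tri0 complex01 matching01.
  move=> [j k]; rewrite mem_cells => /andP[_ kin].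
  by rewrite lin_cellfun ?Df0//; apply: D0_ok.
exists (U tt); apply/funext => g; apply/funext => -[].
have := EU (tt, r g); rewrite mem_cells r_elts => /(_ isT).
by rewrite /lin /= big_seq1 big_nil subr0 /cellfun /= rK => ->.
Qed.

Lemma tt_pred : [:: tt] =i predT. Proof. by case. Qed.
Lemma bool_pred : [:: false; true] =i predT. Proof. by case. Qed.

Lemma D1_D0 f : op D1 (op D0 f) = 0.
Proof. exact: op_comp0 D0_ok D1_ok bool_pred complex12. Qed.

Lemma D2_D1 f : op D2 (op D1 f) = 0.
Proof. exact: op_comp0 D1_ok D2_ok tt_pred complex23. Qed.

Lemma aug_D2 f : aug (op D2 f) = 0.
Proof.
transitivity (lin (cellfun (op D2 f)) (aug_row tt)) => //.
rewrite -(lin_cells_comp _ D2_ok).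
  by rewrite lin_comp lin_perm0//; have /andP[] := complex34.
exact: aug_row_ok.
Qed.

Lemma D1_exact w : op D1 w = 0 -> exists u, op D0 u = w.
Proof.
have /and3P[tri _ _] := matching01.
exact: op_exact D0_ok D1_ok bool_pred tri complex12 matching12.
Qed.

Lemma D2_exact w : op D2 w = 0 -> exists u, op D1 u = w.
Proof.
have /and3P[tri _ _] := matching12.
exact: op_exact D1_ok D2_ok bool_pred tri complex23 matching23.
Qed.

(** The augmentation is a single row in which all cells occur.  All but one
    cell are matched with cells of lower dimension, and that row forces the
    value at the remaining one. *)
Lemma aug_exact w : aug w = 0 -> exists u, op D2 u = w.
Proof.
move=> w0; have /and3P[tri _ _] := matching23.
have [|U DU] := matching_exact (w := cellfun w) tri complex34 matching34.
  by move=> [] _.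
exists (uncellfun U); apply/funext => g; apply/funext => -[].
rewrite (op_uncellfun D2_ok) DU ?mem_cells ?r_elts//.
by rewrite /cellfun /= rK.
Qed.

Lemma aug_surj (n : trivial_gmodule G int) : exists f, aug f = n.
Proof.
pose f : coind G (unit -> int) := fun x _ => if x == 1%g then n else 0.
exists f; rewrite augE (bigD1_seq (r 1%g)) ?elts_uniq//= /f rK eqxx.
rewrite big1_seq ?addr0// => k /andP[kr kin]; case: eqP => // ek.
by rewrite -ek eK// eqxx in kr.
Qed.

End Operators.

(** * The cohomology groups *)

Lemma intr_Zp_eq0 n (z : int) : (1 < n)%N -> (z%:~R == 0 :> 'Z_n) = (n%:Z %| z)%Z.
Proof.
move=> n1; have natE k : (k%:R == 0 :> 'Z_n) = (n %| k)%N.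
  by rewrite -val_eqE /= val_Zp_nat.
case: z => k; first by rewrite -pmulrn natE.
by rewrite NegzE mulrNz oppr_eq0 -pmulrn natE dvdzE abszN.
Qed.

Lemma Zp_surj n (t : 'Z_n) : ((val t)%:Z)%:~R = t.
Proof. by rewrite -pmulrn natr_Zp. Qed.

Definition zero_add (V W : zmodType) : {additive V -> W} := (\0 : V -> W).

Section Periodicity.
Variables (G : groupType) (e : qcoord -> G) (r : G -> qcoord).
Hypotheses (r_elts : forall g, r g \in elts) (rK : cancel r e).
Hypothesis eK : {in elts, cancel e r}.
Hypothesis eM : {in elts &, {morph e : x y / kmul x y >-> (x * y)%g}}.

Notation Z := (trivial_gmodule G int).
Notation d0 := (op e D0).
Notation d1 := (op e D1).
Notation d2 := (op e D2).
Notation coaug := (coaug G).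
Notation sigma := (aug e).

Let d0G : equivariant d0 := op_equivariant e D0.
Let d1G : equivariant d1 := op_equivariant e D1.
Let d2G : equivariant d2 := op_equivariant e D2.
Let sG : equivariant sigma := aug_equivariant r_elts rK eK.
Let d1d0 := D1_D0 r_elts rK eM.
Let d2d1 := D2_D1 r_elts rK eM.
Let sd2 := aug_D2 eM.

Notation p0 := (corestrict d1G d1d0).
Notation p1 := (corestrict d2G d2d1).
Notation p2 := (corestrict sG sd2).

Lemma shift_Z q (T : zmodType) : relative_is p0 q T -> cohomology_is Z q.+1 T.
Proof.
apply: (@shift _ _ _ _ coaug p0) => //.
- exact: corestrict_equivariant.
- exact: coaug_inj.
- apply: corestrict_surj; exact: (D1_exact r_elts rK eK eM).
- by move=> n; apply: val_inj; apply: D0_coaug.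
- by move=> b /(congr1 val) /= /(D0_exact r_elts rK eM).
Qed.

Lemma shift_ZS q (T : zmodType) :
  cohomology_is (kernel_gmodule d1G) q.+1 T -> cohomology_is Z q.+2 T.
Proof.
move=> H; apply: shift_Z; apply: relative_isS => //.
- exact: corestrict_equivariant.
- apply: corestrict_surj; exact: (D1_exact r_elts rK eK eM).
Qed.

Lemma shift_d1 q (T : zmodType) : relative_is p1 q T ->
  cohomology_is (kernel_gmodule d1G) q.+1 T.
Proof. apply: kernel_shift; exact: (D2_exact r_elts rK eK eM). Qed.

Lemma shift_d2 q (T : zmodType) : relative_is p2 q T ->
  cohomology_is (kernel_gmodule d2G) q.+1 T.
Proof. apply: kernel_shift; exact: (aug_exact r_elts rK eK eM). Qed.

Lemma shift_aug q (T : zmodType) : relative_is sigma q T ->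
  cohomology_is (kernel_gmodule sG) q.+1 T.
Proof.
apply: (@shift _ _ _ _ (kernel_incl sG) sigma) => //.
- exact: val_inj.
- exact: (aug_surj r_elts rK eK).
- by move=> a; apply: kernelP.
- by move=> b /eqP b0; exists (Kernel (b0 : in_kernel sigma b)).
Qed.

Lemma shift_d1S q (T : zmodType) :
  cohomology_is (kernel_gmodule d2G) q.+1 T ->
  cohomology_is (kernel_gmodule d1G) q.+2 T.
Proof.
apply: (@kernel_shiftS _ _ _ _ _ _ _ _ d2d1).
exact: (D2_exact r_elts rK eK eM).
Qed.

Lemma shift_d2S q (T : zmodType) :
  cohomology_is (kernel_gmodule sG) q.+1 T ->
  cohomology_is (kernel_gmodule d2G) q.+2 T.
Proof.
apply: (@kernel_shiftS _ _ _ _ _ _ _ _ sd2).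
exact: (aug_exact r_elts rK eK eM).
Qed.

(** Four shifts through the exact sequence, from one end Z to the other. *)
Lemma periodicity q (T : zmodType) :
  cohomology_is Z q.+1 T -> cohomology_is Z q.+4.+1 T.
Proof.
move=> H; apply/shift_ZS/shift_d1S/shift_d2S/shift_aug.
apply: relative_isS H => //; exact: (aug_surj r_elts rK eK).
Qed.

(** On constant functions the matrix acts by the exponent sums of the
    relators, as in the abelianization of the group. *)
Lemma d1_cst c : d1 (cst c) = cst (fun j : bool =>
  if j then 2 * c false - 2 * c true else 2 * c true - c false).
Proof.
apply/funext => x; apply/funext => -[];
  by rewrite /= /op_fun /lin /cst /= !(big_cons, big_nil) /=; ring.
Qed.

Lemma d2_cst c : d2 (cst c) = 0.
Proof.
apply/funext => x; apply/funext => -[].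
by rewrite /= /op_fun /lin /cst /= !(big_cons, big_nil) /= subrr.
Qed.

(** On invariants d1 is injective, as its determinant is -2. *)
Lemma cohomology1 : cohomology_is Z 1 'I_1.
Proof.
apply/shift_Z/(relative_is0 (psi := zero_add _ _)) => [t|m minv].
  by exists 0; split=> [g|]; rewrite ?raddf0// [t]ord1.
split=> // _; exists 0; split=> [g|]; first by rewrite raddf0.
rewrite raddf0; apply: val_inj => /=.
have /invariant_cst mE := (kernel_invariant m).1 minv.
have := kernelP m; rewrite mE d1_cst => E.
move: (kernel_val m 1%g) E => c E {mE}.
have E1 : 2 * c false - 2 * c true = 0 :> int := congr1 (fun f => f 1%g true) E.
have E2 : 2 * c true - c false = 0 :> int := congr1 (fun f => f 1%g false) E.
have [cf ct] : c false = 0 /\ c true = 0 by lia.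
by apply/funext => x; apply/funext => -[].
Qed.

(** The image of d1 on invariants consists of the pairs (m, n) with n even, so
    reducing the second coordinate modulo 2 presents the cokernel. *)
Lemma cohomology2 : cohomology_is Z 2 'Z_2.
Proof.
pose psi (m : kernel_gmodule d2G) : 'Z_2 := (kernel_val m 1%g true)%:~R.
have psiB : zmod_morphism psi by move=> x y; apply: intrB.
pose psiA := GRing.isZmodMorphism.Build _ _ psi psiB.
pose Psi : {additive kernel_gmodule d2G -> 'Z_2} := HB.pack psi psiA.
apply/shift_ZS/shift_d1/(relative_is0 (psi := Psi)) => [t|m minv].
  pose c (j : bool) : int := if j then (val t)%:Z else 0.
  have c0 : in_kernel d2 (cst c) by apply/eqP; apply: d2_cst.
  exists (Kernel c0); split; first by apply/kernel_invariant; apply: cst_invariant.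
  by rewrite [Psi _]/(psi _) /psi /= /cst /c Zp_surj.
rewrite [Psi _]/(psi _) /psi.
have /invariant_cst mE := (kernel_invariant m).1 minv.
rewrite {1}mE /cst; move: (kernel_val m 1%g) mE => c mE.
split=> [/eqP|[b [/invariant_cst ->]]].
  rewrite intr_Zp_eq0// => /dvdzP[k ck].
  (* Solving 2 b1 - b0 = m and 2 b0 - 2 b1 = 2 k gives b1 = m + k. *)
  pose b (j : bool) : int := if j then c false + k else c false + 2 * k.
  exists (cst b); split=> //; apply: val_inj; rewrite /= d1_cst mE.
  congr cst; apply/funext => -[]; rewrite /b ?ck; ring.
move/(congr1 val)/(congr1 (fun f : coind G (bool -> int) => f 1%g true)).
rewrite [val m]mE /= d1_cst /cst => ->.
apply/eqP; rewrite intr_Zp_eq0//; apply/dvdzP.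
by exists (b 1%g false - b 1%g true); ring.
Qed.

(** An invariant function with sum 0 is zero. *)
Lemma cohomology3 : cohomology_is Z 3 'I_1.
Proof.
apply/shift_ZS/shift_d1S/shift_d2/(relative_is0 (psi := zero_add _ _)) => [t|m minv].
  by exists 0; split=> [g|]; rewrite ?raddf0// [t]ord1.
split=> // _; exists 0; split=> [g|]; first by rewrite raddf0.
rewrite raddf0; apply: val_inj => /=.
have mI := (kernel_invariant m).1 minv.
have := kernelP m; rewrite aug_const// => /eqP.
rewrite mulrn_eq0 /= => /eqP E.
by rewrite (invariant_cst mI); apply/funext => x; apply/funext => -[].
Qed.

(** The cokernel of the augmentation on invariants: a constant function n has
    the sum 48 n. *)
Lemma cohomology4 : cohomology_is Z 4 'Z_48.
Proof.
pose psi (m : Z) : 'Z_48 := (m : int)%:~R.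
have psiB : zmod_morphism psi by move=> x y; apply: intrB.
pose psiA := GRing.isZmodMorphism.Build _ _ psi psiB.
pose Psi : {additive Z -> 'Z_48} := HB.pack psi psiA.
apply/shift_ZS/shift_d1S/shift_d2S/shift_aug/(relative_is0 (psi := Psi)) => [t|m _].
  by exists (val t)%:Z; split=> //; apply: Zp_surj.
rewrite [Psi _]/(psi _) /psi; split=> [/eqP|[b [binv ->]]].
  rewrite intr_Zp_eq0// => /dvdzP[k ->].
  exists (cst (fun=> k)); split=> //.
  by rewrite aug_const// /cst -mulr_natr.
rewrite aug_const//; apply/eqP; rewrite intr_Zp_eq0//; apply/dvdzP.
by exists (b 1%g tt); rewrite -mulr_natr.
Qed.

Definition reduced_cohomology (q : nat) : zmodType :=
  if (4 %| q)%N then 'Z_48 : zmodType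
  else if (q == 2 %[mod 4])%N then 'Z_2 : zmodType
  else 'I_1 : zmodType.

Lemma positive_degree q : cohomology_is Z q.+1 (reduced_cohomology q.+1).
Proof.
have [n le_qn] := ubnP q; elim: n q le_qn => // n IH [|[|[|[|q]]]] le_qn.
- exact: cohomology1.
- exact: cohomology2.
- exact: cohomology3.
- exact: cohomology4.
have -> : reduced_cohomology q.+4.+1 = reduced_cohomology q.+1.
  by rewrite /reduced_cohomology -addn4 -[q.+4.+1]addn4 dvdn_addl// modnDr.
apply/periodicity/IH; lia.
Qed.

End Periodicity.

Theorem corollary4p3p4 (R : realType) (q : nat) :
  zmod_isomorphic
    (group_cohomology (trivial_gmodule (binary_octahedral R) int) q)
    (if q == 0%N then int : zmodType
     else if (4 %| q)%N then 'Z_48 : zmodType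
     else if (q == 2 %[mod 4])%N then 'Z_2 : zmodType
     else 'I_1 : zmodType).
Proof.
apply: cohomology_is_isomorphic; case: q => [|q]; first exact: cohomology0.
have [e [r [r_elts rK eK eM]]] := octahedral_model R.
exact: positive_degree r_elts rK eK eM q.
Qed.
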